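(* Let $a,b$ be nonzero real numbers, let $\mathcal{F}_n=\mathcal{F}_n(a,b,x)$ be the bi-periodic Fibonacci matrix polynomials, let $\mathcal{A}_{n}(a,b,x)=\sqrt{x}\,a^{\varepsilon(n)/2}b^{(1-\varepsilon(n))/2}\mathcal{F}_{n}(a,b,x)$, and let $b_n(a,b,x)=\sum_{i=0}^{n}\binom{n}{i}\mathcal{A}_i(a,b,x)$ be its binomial transform ($n\ge 0$). Let $r_1(x),r_2(x)$ be the roots of $r^{2}-(x\sqrt{ab}+2)r+x\sqrt{ab}=0$, and let $$C=\frac{bx\sqrt{ax}\,\mathcal{F}_{0}(a,b,x)-2\sqrt{ax}\,\mathcal{F}_{1}(a,b,x)}{2\sqrt{abx^{2}+4}}.$$ Then: (i) for all $n\ge 0$, $$b_{n+1}(a,b,x)=\sum_{i=0}^{n}\binom{n}{i}\sqrt{x}\,a^{\frac{\varepsilon(i)}{2}}b^{\frac{1-\varepsilon(i)}{2}}\left(\mathcal{F}_{i}(a,b,x)+a^{\frac{1-2\varepsilon(i)}{2}}b^{\frac{2\varepsilon(i)-1}{2}}\mathcal{F}_{i+1}(a,b,x)\right);$$ (ii) for all $n\ge 1$, $b_{n+1}(a,b,x)=(x\sqrt{ab}+2)\,b_{n}(a,b,x)-x\sqrt{ab}\,b_{n-1}(a,b,x)$; (iii) for all $n\ge 0$, $b_{n}(a,b,x)=C\left(r_{2}^{n}(x)-r_{1}^{n}(x)\right)+\frac{\sqrt{bx}\,\mathcal{F}_{0}(a,b,x)}{2}\left(r_{2}^{n}(x)+r_{1}^{n}(x)\right)$;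 (iv) the ordinary generating function satisfies, as formal power series in $t$, $$\sum_{n=0}^{\infty}b_n(a,b,x)t^n=\frac{\sqrt{bx}\,\mathcal{F}_{0}(a,b,x)+t\left(\sqrt{ax}\,\mathcal{F}_{1}(a,b,x)-\sqrt{bx}\,(1+x\sqrt{ab})\mathcal{F}_{0}(a,b,x)\right)}{1-(x\sqrt{ab}+2)t+x\sqrt{ab}\,t^{2}};$$ (v) as formal power series in $t$, $$\sum_{n=0}^{\infty}\frac{b_{n}(a,b,x)t^{n}}{n!}=C\left(e^{r_{2}(x)t}-e^{r_{1}(x)t}\right)+\frac{\sqrt{bx}}{2}\mathcal{F}_{0}(a,b,x)\left(e^{r_{2}(x)t}+e^{r_{1}(x)t}\right).$$
   Context: Here $\varepsilon(n)=n-2\lfloor n/2\rfloor$ and $x$ is an indeterminate over $\mathbb{R}$; everything takes place in an algebraic closure of $\mathbb{R}(x)$, in which square roots $\sqrt a,\sqrt b,\sqrt x,\sqrt{abx^2+4}$ are fixed once and for all, with $\sqrt{ab}=\sqrt a\sqrt b$, $\sqrt{ax}=\sqrt a\sqrt x$, $\sqrt{bx}=\sqrt b\sqrt x$, and half-integer powers of $a$ and $b$ are taken with respect to $\sqrt a,\sqrt b$. The roots are labelled so that $r_1(x)-r_2(x)=\sqrt{abx^2+4}$. The bi-periodic Fibonacci matrix polynomials are the $2\times 2$ matrices defined by $\mathcal{F}_0(a,b,x)=\begin{pmatrix}1&0\\0&1\end{pmatrix}$, $\mathcal{F}_1(a,b,x)=\begin{pmatrix}bx&\frac{b}{a}\\1&0\end{pmatrix}$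 and, for $n\ge 2$, $\mathcal{F}_n=ax\,\mathcal{F}_{n-1}+\mathcal{F}_{n-2}$ if $n$ is even, $\mathcal{F}_n=bx\,\mathcal{F}_{n-1}+\mathcal{F}_{n-2}$ if $n$ is odd. *)

(* Defs.v *)
From HB Require Import structures.
From mathcomp Require Import all_boot all_order all_algebra.
From mathcomp Require Import reals.

Set Implicit Arguments.
Unset Strict Implicit.
Unset Printing Implicit Defensive.

Import Order.TTheory GRing.Theory Num.Theory.
Local Open Scope ring_scope.

(* The parity function n - 2 * floor(n / 2), with values in int because it
   occurs in exponents that may be negative. *)
Definition eps (n : nat) : int := n%:Z - 2 * (n %/ 2)%N%:Z.

Definition binomial_transform (V : nmodType) (u : nat -> V) (n : nat) : V :=
  \sum_(i < n.+1) u i *+ 'C(n, i).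

Section BiperiodicFibonacci.
Variables (R : fieldType) (a b : R).

Definition fib_mx1 : 'M[{poly R}]_2 :=
  \matrix_(i < 2, j < 2)
    nth 0 (nth [::] [:: [:: b *: 'X; (b / a)%:P];
                        [:: 1      ; 0         ]] i) j.

Fixpoint fib_mx (n : nat) : 'M[{poly R}]_2 :=
  match n with
  | 0 => 1%:M
  | 1 => fib_mx1
  | (m.+1 as k).+1 =>
      ((if odd n then b else a) *: 'X) *: fib_mx k + fib_mx m
  end.

End BiperiodicFibonacci.

(* A formal power series in t with coefficients in V is its coefficient
   sequence nat -> V; equality of series is the pointwise equality =1. *)
Section FormalPowerSeries.
Variable (K : fieldType).
Implicit Types f : nat -> K.

(* Cauchy product of a scalar series with a V-valued one *)
Definition fps_mul (V : lmodType K) f (g : nat -> V) (n : nat) : V :=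
  \sum_(i < n.+1) f i *: g (n - i)%N.

Fixpoint fps_inv_seq f (n : nat) : seq K :=
  if n is m.+1 then
    let s := fps_inv_seq f m in
    rcons s ((f 0%N)^-1 * ((m == 0%N)%:R - \sum_(j < m) f (m - j)%N * s`_j))
  else [::].

(* The inverse of f in K[[t]] when f 0 != 0; see fps_mulV. *)
Definition fps_inv f (n : nat) : K := (fps_inv_seq f n.+1)`_n.

Definition fps_div (V : lmodType K) (g : nat -> V) f : nat -> V :=
  fps_mul (fps_inv f) g.

Definition fps_of_poly (A : nzRingType) (p : {poly A}) (n : nat) : A := p`_n.

(* exp(r t) *)
Definition fps_exp (r : K) (n : nat) : K := r ^+ n / n`!%:R.

Lemma size_fps_inv_seq f n : size (fps_inv_seq f n) = n.
Proof. by elim: n => //= n IHn; rewrite size_rcons IHn. Qed.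

Lemma nth_fps_inv_seq f n j : (j < n)%N -> (fps_inv_seq f n)`_j = fps_inv f j.
Proof.
elim: n => // n IHn; rewrite ltnS leq_eqVlt => /orP[/eqP -> //|ltjn].
by rewrite /= nth_rcons size_fps_inv_seq ltjn IHn.
Qed.

Lemma fps_invE f n :
  fps_inv f n =
  (f 0%N)^-1 * ((n == 0%N)%:R - \sum_(j < n) f (n - j)%N * fps_inv f j).
Proof.
rewrite {1}/fps_inv /= nth_rcons size_fps_inv_seq ltnn eqxx.
by congr (_ * (_ - _)); apply: eq_bigr => j _; rewrite nth_fps_inv_seq.
Qed.

Lemma fps_mulV f : f 0%N != 0 ->
  fps_mul (V := K^o) (fps_inv f) f =1 fun n => (n == 0%N)%:R.
Proof.
move=> f0 n; rewrite /fps_mul big_ord_recr /= subnn [fps_inv f n]fps_invE.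
rewrite [X in _ + X]mulrC mulrA divff // mul1r addrC -addrA -[RHS]addr0.
congr (_ + _); rewrite addrC; apply/eqP; rewrite subr_eq0; apply/eqP.
by apply: eq_bigr => j _; rewrite mulrC.
Qed.

End FormalPowerSeries.

(* Main.v *)
Require Import Defs.
From HB Require Import structures.
From mathcomp Require Import all_boot all_order all_algebra.
From mathcomp Require Import reals.
From mathcomp Require Import ring.

Set Implicit Arguments.
Unset Strict Implicit.
Unset Printing Implicit Defensive.

Import Order.TTheory GRing.Theory Num.Theory.
Local Open Scope ring_scope.

(** The weights [sqrt a], [sqrt b] are chosen so that the weighted matrices
    [A n] satisfy one recurrence with constant coefficients,
    [A (n+2) = s A (n+1) + A n] with [s = x sqrt (a b)], whereas the matrices
    [F n] alternate between two ([symm_fib_mx_rec]).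

    The binomial transform at [n] is [(1 + E)^n] applied to [A] and read at
    index [0], where [E] is the shift. Splitting off one factor [1 + E] gives
    (i) ([binomial_transformS], [symm_fib_mxS]). Since [E^2 = s E + 1] on [A],
    the operator [T = 1 + E] satisfies [T^2 = (s + 2) T - s], which is (ii)
    ([binomial_transform_rec]).

    Everything else follows from (ii) and the two initial values
    [B 0 = sqrt (b x) F 0] and [B 1 = sqrt (b x) F 0 + sqrt (a x) F 1]. The right
    side of (iii) satisfies the same recurrence because [r1] and [r2] are roots
    of its characteristic polynomial, and it has the same initial values, so
    (iii) is uniqueness ([linear_rec2_eq]); division by [sD] is legitimate
    because [a b x^2 + 4] is a nonzero polynomial ([discriminant_neq0]), and
    for the same reason the two roots are distinct, so that their sum is
    [s + 2]. For (iv), the recurrence says that the denominator times the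
    generating series is the numerator ([fps_mul_linear_rec2]), and the quotient
    is then determined by associativity of the Cauchy product ([fps_divP]).
    Dividing (iii) by [n!] gives (v). *)

(** * Binomial transforms and two-term recurrences *)

Section BinomialTransform.
Variables (S : pzSemiRingType) (V : lSemiModType S).
Implicit Types (u v : nat -> V) (n : nat).

Lemma binomial_transform0 u : binomial_transform u 0 = u 0%N.
Proof. by rewrite /binomial_transform big_ord1 bin0. Qed.

Lemma eq_binomial_transform u v :
  u =1 v -> binomial_transform u =1 binomial_transform v.
Proof. by move=> uv n; apply: eq_bigr => i _; rewrite uv. Qed.

Lemma binomial_transformD u v n :
  binomial_transform (fun i => u i + v i) n
  = binomial_transform u n + binomial_transform v n.
Proof.
by rewrite /binomial_transform -big_split; apply: eq_bigr => i _; rewrite mulrnDl.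
Qed.

Lemma binomial_transformZ (c : S) u n :
  binomial_transform (fun i => c *: u i) n = c *: binomial_transform u n.
Proof.
by rewrite /binomial_transform scaler_sumr; apply: eq_bigr => i _; rewrite scalerMnr.
Qed.

(** Pascal's rule: as an operator on sequences the [n]-th term of the
    transform is [(1 + E)^n] evaluated at index [0], with [E] the shift, and
    here one factor [1 + E] is split off. *)
Lemma binomial_transformS u n :
  binomial_transform u n.+1 = binomial_transform (fun i => u i + u i.+1) n.
Proof.
rewrite binomial_transformD /binomial_transform big_ord_recl bin0.
under eq_bigr => i _ do rewrite lift0 binS mulrnDr.
rewrite big_split /= addrA; congr (_ + _).
by rewrite [in LHS]big_ord_recr /= bin_small // mulr0n addr0 [RHS]big_ord_recl bin0.
Qed.

End BinomialTransform.

(** If the shift [E] satisfies [E^2 = s E + 1], then [T = 1 + E] satisfies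
    [T^2 = (s + 2) T - s]. *)
Lemma binomial_transform_rec (S : comPzRingType) (V : lmodType S) (s : S)
    (u : nat -> V) n :
    (forall m, u m.+2 = s *: u m.+1 + u m) ->
  binomial_transform u n.+2 =
  (s + 2) *: binomial_transform u n.+1 - s *: binomial_transform u n.
Proof.
move=> urec; rewrite !binomial_transformS.
rewrite -scaleNr -!binomial_transformZ -binomial_transformD.
apply: eq_binomial_transform => i; rewrite urec.
rewrite scalerDl scaler_nat scaleNr [RHS]addrAC scalerDr.
rewrite [s *: u i + _]addrC addrK mulr2n.
by rewrite [u i.+1 + _]addrCA [LHS]addrCA [u i.+1 + u i]addrC.
Qed.

Section LinearRecurrence.
Variables (S : pzRingType) (V : lmodType S) (p q : S).
Implicit Types u v : nat -> V.

Lemma linear_rec2_eq u v :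
    (forall n, u n.+2 = p *: u n.+1 - q *: u n) ->
    (forall n, v n.+2 = p *: v n.+1 - q *: v n) ->
  u 0%N = v 0%N -> u 1%N = v 1%N -> u =1 v.
Proof.
move=> urec vrec uv0 uv1 n.
suff [] : u n = v n /\ u n.+1 = v n.+1 by [].
by elim: n => // n [IH0 IH1]; split; rewrite // urec vrec IH0 IH1.
Qed.

Lemma root_linear_rec2 (r : S) n :
  r ^+ 2 - p * r + q = 0 -> r ^+ n.+2 = p * r ^+ n.+1 - q * r ^+ n.
Proof.
move=> r_root; have r2E : r ^+ 2 = p * r - q.
  by apply/eqP; rewrite -subr_eq0 opprB addrA addrAC r_root eqxx.
by rewrite -add2n exprD r2E mulrBl exprS mulrA.
Qed.

End LinearRecurrence.

(** * Quotients of formal power series *)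

Section CauchyProduct.
Variables (K : fieldType) (V : lmodType K).
Implicit Types (f g : nat -> K) (u v : nat -> V).

Lemma eq_fps_mul f g u v : f =1 g -> u =1 v -> fps_mul f u =1 fps_mul g v.
Proof. by move=> fg uv n; apply: eq_bigr => i _; rewrite fg uv. Qed.

Lemma fps_mul1 u : fps_mul (fun n => (n == 0%N)%:R) u =1 u.
Proof.
move=> n; rewrite /fps_mul big_ord_recl scale1r subn0 big1 ?addr0 // => i _.
by rewrite scale0r.
Qed.

(** Both sides sum [f i * g j *: u k] over all [i + j + k = n]; [T i m] is the
    term with [m = i + j]. *)
Lemma fps_mulA f g u :
  fps_mul f (fps_mul g u) =1 fps_mul (fps_mul (V := K^o) f g) u.
Proof.
move=> n; pose T i m := (f i * g (m - i)%N) *: u (n - m)%N.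
transitivity (\sum_(i < n.+1) \sum_(m < n.+1 | (i <= m)%N) T i m).
  apply: eq_bigr => i _; rewrite /fps_mul scaler_sumr.
  have le_in : (i <= n)%N by rewrite -ltnS.
  (* Reindexing by [m = i + j] turns the inner product into a sum over [m]. *)
  rewrite -(big_mkord predT (fun j => f i *: (g j *: u (n - i - j)%N))).
  rewrite -(big_mkord (fun m => i <= m)%N (T i)).
  rewrite [RHS](big_cat_nat _ (n := i)) ?(leqW le_in) //=.
  rewrite [X in _ = X + _]big_nat_cond [X in _ = X + _]big1 ?add0r; last first.
    by move=> m /andP[/= ltmi]; rewrite leqNgt ltmi.
  have := big_addn 0 n.+1 i (leq i) (T i) => /(_ 0 +%R); rewrite add0n => ->.
  rewrite subSn //; apply: eq_big => [j|j _]; first by rewrite leq_addl.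
  by rewrite /T addnK scalerA [(j + i)%N]addnC subnDA.
rewrite (exchange_big_dep predT) //=; apply: eq_bigr => m _.
rewrite big_ord_narrow_leq ?leq_ord // => le_mn; rewrite scaler_suml.
by apply: eq_bigr.
Qed.

Lemma fps_divP f u v : f 0%N != 0 -> fps_mul f v =1 u -> v =1 fps_div u f.
Proof.
move=> f0 fvE n; rewrite /fps_div -(eq_fps_mul (frefl _) fvE) fps_mulA.
rewrite -[LHS]fps_mul1; apply: eq_fps_mul => // i; exact/esym/fps_mulV.
Qed.

(** The polynomial is the characteristic polynomial with its coefficients
    reversed, so each coefficient of the product from index two on is one
    instance of the recurrence. *)
Lemma fps_mul_linear_rec2 (p q : K) u :
    (forall n, u n.+2 = p *: u n.+1 - q *: u n) ->
  fps_mul (fps_of_poly (1 - p *: 'X + q *: 'X^2)) u =1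
  fun n => if n is m.+1 then if m is 0 then u 1%N - p *: u 0%N else 0 else u 0%N.
Proof.
pose d := fps_of_poly (1 - p *: 'X + q *: 'X^2).
have dE i : d i = if i is i.+1 then
    if i is i.+1 then if i is 0 then q else 0 else - p else 1.
  rewrite /d /fps_of_poly !coefE /=.
  by case: i => [|[|[|i]]] /=;
     rewrite ?(mulr0, mulr1, subr0, addr0, oppr0, sub0r, add0r).
move=> urec [|[|n]]; rewrite /fps_mul -/d.
- by rewrite big_ord1 dE scale1r.
- by rewrite big_ord_recl big_ord1 !dE /= scale1r scaleNr.
rewrite 3!big_ord_recl !dE /= big1 => [|i _]; last by rewrite dE scale0r.
by rewrite addr0 scale1r !subSS !subn0 urec scaleNr addrACA subrr addNr addr0.
Qed.

End CauchyProduct.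

(** * Weighted bi-periodic Fibonacci matrices *)

Lemma epsE n : eps n = (odd n)%:Z.
Proof.
rewrite /eps divn2 -[in n%:Z](odd_double_half n) -mul2n PoszD PoszM.
by rewrite addrK.
Qed.

Section BiperiodicFibonacci.
Variables (F : fieldType) (a b : F) (K : fieldType).
Variables (emb : {rmorphism {poly F} -> K}) (sa sb sx : K).
Hypotheses (sa2 : sa ^+ 2 = emb a%:P) (sb2 : sb ^+ 2 = emb b%:P).

(** These are the [A n] of the theorem, for [sx] a square root of [emb 'X]. *)
Definition symm_fib_mx n : 'M[K]_2 :=
  (sx * sa ^ eps n * sb ^ (1 - eps n)) *: map_mx emb (fib_mx a b n).

Lemma symm_fib_mx0 : symm_fib_mx 0 = (sb * sx) *: map_mx emb (fib_mx a b 0).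
Proof. by rewrite /symm_fib_mx epsE expr0z mulr1 subr0 expr1z mulrC. Qed.

Lemma symm_fib_mx1 : symm_fib_mx 1 = (sa * sx) *: map_mx emb (fib_mx a b 1).
Proof. by rewrite /symm_fib_mx epsE subrr expr0z mulr1 expr1z mulrC. Qed.

(** The weights alternate between [sb] and [sa], and
    [sb * (a x) = (x sa sb) * sa], [sa * (b x) = (x sa sb) * sb]: this turns
    the alternating coefficients [a x], [b x] into the single one [x sa sb]. *)
Lemma symm_fib_mx_rec n :
  symm_fib_mx n.+2 = (emb 'X * (sa * sb)) *: symm_fib_mx n.+1 + symm_fib_mx n.
Proof.
rewrite /symm_fib_mx !epsE /= negbK map_mxD map_mxZ scalerDr !scalerA.
congr (_ *: _ + _); rewrite -mul_polyC rmorphM /=.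
by case: (odd n); rewrite /= ?subrr ?subr0 ?expr0z ?expr1z -?sa2 -?sb2; ring.
Qed.

(** The inner scalar is the ratio of the weight at [n + 1] to the weight at
    [n]: [sa / sb] for even [n] and [sb / sa] for odd [n]. *)
Lemma symm_fib_mxS n : sa != 0 -> sb != 0 ->
  symm_fib_mx n.+1 = (sx * sa ^ eps n * sb ^ (1 - eps n)) *:
    ((sa ^ (1 - 2 * eps n) * sb ^ (2 * eps n - 1)) *: map_mx emb (fib_mx a b n.+1)).
Proof.
move=> sa0 sb0; rewrite /symm_fib_mx scalerA !epsE /=; congr (_ *: _).
case: (odd n) => /=; rewrite ?subrr ?subr0 ?expr0z ?expr1z;
  rewrite ?(mulr0, mulr1, sub0r, subr0) -?[2 - 1]/1 -?[1 - 2]/(-1);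
  by rewrite ?exprN1 ?expr1z; field; rewrite ?sa0 ?sb0.
Qed.

End BiperiodicFibonacci.

(** Its coefficient of degree two is [a b]. *)
Lemma discriminant_neq0 (F : fieldType) (a b : F) :
  a != 0 -> b != 0 -> a%:P * b%:P * 'X^2 + 4%:R != 0 :> {poly F}.
Proof.
move=> a0 b0; apply/eqP => /polyP/(_ 2%N); rewrite -polyCM -polyC_natr.
rewrite !coefE /= mulr1 addr0 => /eqP; apply/negP.
by rewrite mulf_neq0.
Qed.

Theorem theorem3p3 (R : realType)
    (* (K, iota) is an algebraic closure of R(x) *)
    (K : closedFieldType) (iota : {rmorphism {fraction {poly R}} -> K})
    (iota_alg : forall z : K, algebraicOver iota z)
    (a b : R) (a_neq0 : a != 0) (b_neq0 : b != 0)
    (sa sb sx sD r1 r2 : K) :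
  let emb (p : {poly R}) : K := iota (tofrac p) in
  let aK := emb a%:P in
  let bK := emb b%:P in
  let x := emb 'X in
  let sab := sa * sb in
  let sax := sa * sx in
  let sbx := sb * sx in
  let F (n : nat) : 'M[K]_2 := map_mx emb (fib_mx a b n) in
  let A (n : nat) : 'M[K]_2 := (sx * sa ^ eps n * sb ^ (1 - eps n)) *: F n in
  let B : nat -> 'M[K]_2 := binomial_transform A in
  let C : 'M[K]_2 :=
    (2 * sD)^-1 *: ((bK * x * sax) *: F 0%N - (2 * sax) *: F 1%N) in
  sa ^+ 2 = aK -> sb ^+ 2 = bK -> sx ^+ 2 = x ->
  sD ^+ 2 = aK * bK * x ^+ 2 + 4 ->
  (forall r : K, r ^+ 2 - (x * sab + 2) * r + x * sab = 0 <->
                 r = r1 \/ r = r2) ->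
  r1 - r2 = sD ->
  [/\ (* (i) *)
      forall n : nat,
        B n.+1 = \sum_(i < n.+1)
          ('C(n, i)%:R * (sx * sa ^ eps i * sb ^ (1 - eps i))) *:
            (F i + (sa ^ (1 - 2 * eps i) * sb ^ (2 * eps i - 1)) *: F i.+1),
      (* (ii) *)
      forall n : nat, (1 <= n)%N ->
        B n.+1 = (x * sab + 2) *: B n - (x * sab) *: B n.-1,
      (* (iii) *)
      forall n : nat,
        B n = (r2 ^+ n - r1 ^+ n) *: C
              + (r2 ^+ n + r1 ^+ n) *: ((sbx / 2) *: F 0%N),
      (* (iv) *)
      B =1 fps_div
             (fps_of_poly
                ((sbx *: F 0%N)%:P
                 + (sax *: F 1%N - (sbx * (1 + x * sab)) *: F 0%N)%:P * 'X))
             (fps_of_poly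
                (1 - (x * sab + 2) *: 'X + (x * sab) *: 'X^2))
    & (* (v) *)
      (fun n => (n`!%:R)^-1 *: B n) =1
      (fun n => (fps_exp r2 n - fps_exp r1 n) *: C
                + (fps_exp r2 n + fps_exp r1 n) *: ((sbx / 2) *: F 0%N))].
Proof.
move=> emb aK bK x sab sax sbx F A B C sa2 sb2 sx2 sD2 rootsP rB.
pose phi : {rmorphism {poly R} -> K} := iota \o @tofrac {poly R}.
have phi_eq0 p : (phi p == 0) = (p == 0) by rewrite fmorph_eq0 tofrac_eq0.
have two0 : 2 != 0 :> K.
  by rewrite -(rmorph_nat phi) phi_eq0 -polyC_natr polyC_eq0 pnatr_eq0.
have sa0 : sa != 0 by rewrite -(sqrf_eq0 sa) sa2 [_ == _]phi_eq0 polyC_eq0.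
have sb0 : sb != 0 by rewrite -(sqrf_eq0 sb) sb2 [_ == _]phi_eq0 polyC_eq0.
have sD0 : sD != 0.
  rewrite -(sqrf_eq0 sD) sD2; have := discriminant_neq0 a_neq0 b_neq0.
  by rewrite -phi_eq0 rmorphD rmorphM rmorphXn rmorphM rmorph_nat.
have r1P : r1 ^+ 2 - (x * sab + 2) * r1 + x * sab = 0 by apply/rootsP; left.
have r2P : r2 ^+ 2 - (x * sab + 2) * r2 + x * sab = 0 by apply/rootsP; right.
(* The difference of the two root equations is [sD * (r1 + r2 - (x * sab + 2))]. *)
have r_sum : r2 + r1 = x * sab + 2.
  apply: (mulfI sD0); rewrite -rB; apply/eqP; rewrite -subr_eq0; apply/eqP.
  by rewrite -[RHS](subrr 0) -{1}r1P -r2P; ring.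
have A0 : A 0%N = sbx *: F 0%N by exact: (symm_fib_mx0 _ _ phi).
have A1 : A 1%N = sax *: F 1%N by exact: (symm_fib_mx1 _ _ phi).
have Arec n : A n.+2 = (x * sab) *: A n.+1 + A n.
  exact: (symm_fib_mx_rec (emb := phi) sx sa2 sb2).
have B0 : B 0%N = sbx *: F 0%N by rewrite /B binomial_transform0 A0.
have B1 : B 1%N = sbx *: F 0%N + sax *: F 1%N.
  by rewrite /B binomial_transformS binomial_transform0 A0 A1.
have Brec n : B n.+2 = (x * sab + 2) *: B n.+1 - (x * sab) *: B n.
  exact: binomial_transform_rec Arec.
have Binet n : B n = (r2 ^+ n - r1 ^+ n) *: C
                     + (r2 ^+ n + r1 ^+ n) *: ((sbx / 2) *: F 0%N).
  move: n; apply: (linear_rec2_eq Brec) => [n||].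
  - rewrite !(root_linear_rec2 _ r1P) !(root_linear_rec2 _ r2P).
    by apply/matrixP => i j; rewrite !mxE; ring.
  - rewrite B0; apply/matrixP => i j; rewrite !mxE; field.
    by rewrite two0.
  (* With [bK = sb ^+ 2], the [F 0] part of [(r2 - r1) *: C] is
     [- (x * sab / 2) * sbx], which cancels against [r_sum]. *)
  - rewrite B1 r_sum -(opprB r1) rB /C /sbx /sax /sab -sb2.
    move: (F 0%N) (F 1%N) => F0 F1.
    by apply/matrixP => i j; rewrite !mxE; field; rewrite two0 sD0.
split => //.
- move=> n; rewrite /B binomial_transformS; apply: eq_bigr => i _.
  have -> : A i.+1 = (sx * sa ^ eps i * sb ^ (1 - eps i)) *:
      ((sa ^ (1 - 2 * eps i) * sb ^ (2 * eps i - 1)) *: F i.+1).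
    exact: (symm_fib_mxS _ _ phi).
  by rewrite -scalerDr -scaler_nat scalerA.
- by case=> // n _; rewrite Brec.
- apply: fps_divP => [|n].
    by rewrite /fps_of_poly !coefE /= !mulr0 subr0 addr0 oner_neq0.
  rewrite (fps_mul_linear_rec2 Brec) /fps_of_poly.
  rewrite coefD coefC coefMX coefC.
  case: n => [|[|n]] /=; rewrite ?addr0 ?add0r // B1 B0.
  by rewrite scalerA; apply/matrixP => i j; rewrite !mxE; ring.
- move=> n; rewrite /fps_exp -mulrBl -mulrDl Binet scalerDr !scalerA.
  by congr (_ *: _ + _ *: _); ring.
Qed.
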